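(* Let $K$ be a commutative ring with $\frac12\in K$, let $n\ge1$ and let $\Lambda_n=\Lambda_n(K)$ be the Grassmann algebra. Then: 1. $\mathrm{SDer}_K(\Lambda_n)=\mathrm{SDer}_K(\Lambda_n)^{ev}\oplus\mathrm{SDer}_K(\Lambda_n)^{od}$. 2. $\mathrm{SDer}_K(\Lambda_n)^{od}=\bigoplus_{i=1}^n\Lambda_n^{ev}\partial_i$. 3. $\mathrm{SDer}_K(\Lambda_n)^{ev}=\mathrm{ISDer}_K(\Lambda_n)=\{\mathrm{sad}(a)\mid a\in\Lambda_n'^{ev}\}$, and the map $\mathrm{sad}:\Lambda_n'^{ev}\to\mathrm{ISDer}_K(\Lambda_n)$, $a\mapsto\mathrm{sad}(a)$, is a bijection. 4. $\mathrm{SDer}_K(\Lambda_n)/\mathrm{ISDer}_K(\Lambda_n)\simeq\mathrm{SDer}_K(\Lambda_n)^{od}$ (as left $\Lambda_n^{ev}$-modules).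
   Context: $\Lambda_n=\Lambda_n(K)=K\lfloor x_1,\ldots,x_n\rfloor$ is the $K$-algebra with generators $x_1,\ldots,x_n$ and defining relations $x_i^2=0$, $x_ix_j=-x_jx_i$ ($i\ne j$); it is a free $K$-module with basis $x^\alpha=x_1^{\alpha_1}\cdots x_n^{\alpha_n}$, $\alpha\in\{0,1\}^n$. Put $|\alpha|=\alpha_1+\cdots+\alpha_n$, $\Lambda_{n,i}=\bigoplus_{|\alpha|=i}Kx^\alpha$, $\Lambda_n^{ev}=\bigoplus_{i\text{ even}}\Lambda_{n,i}$, $\Lambda_n^{od}=\bigoplus_{i\text{ odd}}\Lambda_{n,i}$. A (left) skew $K$-derivation of $\Lambda_n$ is a $K$-linear map $\delta:\Lambda_n\to\Lambda_n$ such that $\delta(ab)=\delta(a)b+(-1)^s a\,\delta(b)$ for all homogeneous $a,b$ with respect to the parity grading, where $s=0$ if $a\in\Lambda_n^{ev}$ and $s=1$ if $a\in\Lambda_n^{od}$. $\mathrm{SDer}_K(\Lambda_n)$ is the set of all skew $K$-derivations; it is a left $\Lambda_n^{ev}$-module. $\mathrm{SDer}_K(\Lambda_n)^{ev}$ is the set of those preserving parity ($\delta(\Lambda_n^{ev})\subseteq\Lambda_n^{ev}$, $\delta(\Lambda_n^{od})\subseteq\Lambda_n^{od}$), and $\mathrm{SDer}_K(\Lambda_n)^{od}$ the set of those reversing parity. $\partial_i$ is the skew $K$-derivation with $\partial_i(x_j)=\delta_{ij}$; $\Lambda_n^{ev}\partial_i$ denotes the set of maps $b\mapsto a\partial_i(b)$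 with $a\in\Lambda_n^{ev}$. For $a\in\Lambda_n$, the inner skew derivation $\mathrm{sad}(a)$ is the $K$-linear map with $\mathrm{sad}(a)(b)=ab-(-1)^s ba$, where $s=0$ for $b\in\Lambda_n^{ev}$ and $s=1$ for $b\in\Lambda_n^{od}$. $\mathrm{ISDer}_K(\Lambda_n)=\{\mathrm{sad}(a)\mid a\in\Lambda_n\}$. $\Lambda_n'^{ev}=\Lambda_n^{ev}$ if $n$ is odd; if $n$ is even, $\Lambda_n'^{ev}$ is the $K$-submodule of $\Lambda_n^{ev}$ spanned by all even-degree monomials $x^\alpha$ other than $x_1\cdots x_n$. *)

(* Defs.v *)
From HB Require Import structures.
From mathcomp Require Import boolp functions.
From mathcomp Require Import all_boot all_order all_algebra.

Set Implicit Arguments.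
Unset Strict Implicit.
Unset Printing Implicit Defensive.

Import GRing.Theory.
Local Open Scope ring_scope.

Section GrassmannDef.
Variables (K : comPzRingType) (n : nat).
Implicit Types (A B C S T : {set 'I_n}) (i j : 'I_n).

(* A multi-index alpha in {0,1}^n is represented by its support S : {set 'I_n},
   and an element sum_alpha c_alpha x^alpha by its coefficients S |-> c_S. *)
Record grassmann := Grassmann { gcoef : {ffun {set 'I_n} -> K} }.

HB.instance Definition _ := [isNew for gcoef].
HB.instance Definition _ := [Choice of grassmann by <:].

Implicit Types a b c : grassmann.

Definition gfun a S := gcoef a S.
Coercion gfun : grassmann >-> Funclass.

Definition gmk (f : {set 'I_n} -> K) := Grassmann [ffun S => f S].

Lemma gmkE f S : gmk f S = f S. Proof. by rewrite /gfun ffunE. Qed.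

Lemma grassmannP a b : (forall S, a S = b S) <-> a = b.
Proof.
by split=> [ab|->//]; apply: val_inj; apply/ffunP => S; apply: ab.
Qed.

(* x_A x_B = geps A B *: x_(A :|: B): the sign counts the transpositions needed
   to sort the concatenation of the increasing words A and B. *)
Definition ninv A B := (\sum_(i in A) \sum_(j in B) (j < i : nat))%N.
Definition geps A B : K := if [disjoint A & B] then (-1) ^+ ninv A B else 0.

Definition gzero := gmk (fun=> 0).
Definition gopp a := gmk (fun S => - a S).
Definition gadd a b := gmk (fun S => a S + b S).
Definition gscale (k : K) a := gmk (fun S => k * a S).
Definition gone := gmk (fun S => (S == set0)%:R).
Definition gmul a b :=
  gmk (fun S => \sum_A \sum_(B | A :|: B == S) geps A B * (a A * b B)).

Let gaddA : associative gadd.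
Proof. by move=> a b c; apply/grassmannP => S; rewrite !gmkE addrA. Qed.
Let gaddC : commutative gadd.
Proof. by move=> a b; apply/grassmannP => S; rewrite !gmkE addrC. Qed.
Let gadd0 : left_id gzero gadd.
Proof. by move=> a; apply/grassmannP => S; rewrite !gmkE add0r. Qed.
Let gaddN : left_inverse gzero gopp gadd.
Proof. by move=> a; apply/grassmannP => S; rewrite !gmkE addNr. Qed.

HB.instance Definition _ :=
  GRing.isZmodule.Build grassmann gaddA gaddC gadd0 gaddN.

Let gscaleA k l a : gscale k (gscale l a) = gscale (k * l) a.
Proof. by apply/grassmannP => S; rewrite !gmkE mulrA. Qed.
Let gscale1 : left_id 1 gscale.
Proof. by move=> a; apply/grassmannP => S; rewrite !gmkE mul1r. Qed.
Let gscaleDr : right_distributive gscale +%R.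
Proof. by move=> k a b; apply/grassmannP => S; rewrite !gmkE mulrDr. Qed.
Let gscaleDl a : {morph gscale^~ a : k l / k + l}.
Proof. by move=> k l; apply/grassmannP => S; rewrite !gmkE mulrDl. Qed.

HB.instance Definition _ :=
  GRing.Zmodule_isLmodule.Build K grassmann gscaleA gscale1 gscaleDr gscaleDl.

Lemma gzeroE S : (0 : grassmann) S = 0. Proof. exact: gmkE. Qed.
Lemma goppE a S : (- a) S = - a S. Proof. exact: gmkE. Qed.
Lemma gaddE a b S : (a + b) S = a S + b S. Proof. exact: gmkE. Qed.
Lemma gscaleE k a S : (k *: a) S = k * a S. Proof. exact: gmkE. Qed.
Lemma gsumE I (r : seq I) (P : pred I) (F : I -> grassmann) S :
  (\sum_(i <- r | P i) F i) S = \sum_(i <- r | P i) F i S.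
Proof.
elim/big_rec2: _ => [|i x y _ <-]; first exact: gzeroE.
by rewrite gaddE.
Qed.


Lemma ninvUl A B C : [disjoint A & B] ->
  ninv (A :|: B) C = (ninv A C + ninv B C)%N.
Proof.
move=> dAB; rewrite /ninv -bigU //.
by apply: eq_bigl => i; rewrite !inE.
Qed.

Lemma ninvUr A B C : [disjoint B & C] ->
  ninv A (B :|: C) = (ninv A B + ninv A C)%N.
Proof.
move=> dBC; rewrite /ninv -big_split /=; apply: eq_bigr => i _.
by rewrite -bigU //; apply: eq_bigl => j; rewrite !inE.
Qed.

Lemma ninv0l A : ninv set0 A = 0%N. Proof. by rewrite /ninv big_set0. Qed.
Lemma ninv0r A : ninv A set0 = 0%N.
Proof. by rewrite /ninv big1 // => i _; rewrite big_set0. Qed.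

Lemma disjointUl A B C :
  [disjoint A :|: B & C] = [disjoint A & C] && [disjoint B & C].
Proof. by rewrite -!setI_eq0 setIUl setU_eq0. Qed.

Lemma disjointUr A B C :
  [disjoint C & A :|: B] = [disjoint C & A] && [disjoint C & B].
Proof. by rewrite -!setI_eq0 setIUr setU_eq0. Qed.

Lemma geps_cocycle A B C :
  geps A B * geps (A :|: B) C = geps A (B :|: C) * geps B C.
Proof.
rewrite /geps disjointUl disjointUr.
case dAB: [disjoint A & B]; case dBC: [disjoint B & C];
  rewrite ?andbF ?andbT ?mul0r ?mulr0 //=.
case: ifP => _; rewrite ?mul0r ?mulr0 //.
by rewrite -!exprD ninvUl // ninvUr // addnA.
Qed.

Lemma geps0l A : geps set0 A = 1.
Proof. by rewrite /geps -setI_eq0 set0I eqxx ninv0l expr0. Qed.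
Lemma geps0r A : geps A set0 = 1.
Proof. by rewrite /geps -setI_eq0 setI0 eqxx ninv0r expr0. Qed.

Lemma gmul_sumE a b (F : {set 'I_n} -> K) :
  \sum_S gmul a b S * F S = \sum_A \sum_B geps A B * (a A * b B) * F (A :|: B).
Proof.
under eq_bigr do rewrite gmkE mulr_suml.
rewrite exchange_big; apply: eq_bigr => A _ /=.
under eq_bigr do rewrite mulr_suml.
rewrite (exchange_big_dep xpredT) //=; apply: eq_bigr => B _.
by rewrite (big_pred1 (A :|: B)) // => S; rewrite /= eq_sym.
Qed.


Let gmulA : associative (@gmul).
Proof.
move=> a b c; apply/grassmannP => S.
pose cf A B C := geps A B * geps (A :|: B) C * (a A * b B * c C).
transitivity (\sum_A \sum_B \sum_(C | A :|: B :|: C == S) cf A B C); last first.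
  rewrite gmkE; under [RHS]eq_bigr do rewrite big_mkcond.
  rewrite [RHS]exchange_big /=.
  pose F C A := if A :|: C == S then geps A C * c C else 0.
  transitivity (\sum_C \sum_A gmul a b A * F C A); last first.
    apply: eq_bigr => C _; apply: eq_bigr => A _; rewrite /F.
    by case: ifP => _; rewrite ?mulr0 // mulrCA.
  under [RHS]eq_bigr do rewrite gmul_sumE.
  rewrite [RHS]exchange_big; apply: eq_bigr => A _ /=.
  rewrite [RHS]exchange_big; apply: eq_bigr => B _ /=.
  rewrite big_mkcond; apply: eq_bigr => C _; rewrite /F /cf.
  by case: ifP => _; rewrite ?mulr0 // mulrACA.
rewrite gmkE; apply: eq_bigr => A _.
under [LHS]eq_bigr do rewrite mulrCA.
pose F D := if A :|: D == S then geps A D * a A else 0.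
transitivity (\sum_D gmul b c D * F D).
  rewrite big_mkcond; apply: eq_bigr => D _; rewrite /F.
  by case: ifP => _; rewrite ?mulr0 // [RHS]mulrC mulrCA mulrA.
rewrite gmul_sumE; apply: eq_bigr => B _.
rewrite [RHS]big_mkcond; apply: eq_bigr => C _; rewrite /F /cf setUA.
case: ifP => _; rewrite ?mulr0 // geps_cocycle mulrACA.
by congr (_ * _); [rewrite mulrC | rewrite mulrC mulrA].
Qed.

Let gmul1l : left_id gone (@gmul).
Proof.
move=> a; apply/grassmannP => S; rewrite gmkE (bigD1 set0) //= [X in _ + X]big1.
  under eq_bigl do rewrite set0U.
  by rewrite big_pred1_eq addr0 gmkE eqxx mul1r geps0l mul1r.
by move=> A /negPf A0; rewrite big1 // => B _; rewrite gmkE A0 mul0r mulr0.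
Qed.

Let gmul1r : right_id gone (@gmul).
Proof.
move=> a; apply/grassmannP => S; rewrite gmkE.
under eq_bigr do rewrite big_mkcond.
rewrite exchange_big (bigD1 set0) //= [X in _ + X]big1.
  rewrite -big_mkcond; under eq_bigl do rewrite setU0.
  by rewrite big_pred1_eq addr0 gmkE eqxx mulr1 geps0r mul1r.
move=> A /negPf A0; rewrite big1 // => B _.
by rewrite gmkE A0 !mulr0; case: ifP.
Qed.

Let gmulDl : left_distributive (@gmul) +%R.
Proof.
move=> a b c; apply/grassmannP => S; rewrite gaddE !gmkE -big_split.
apply: eq_bigr => A _; rewrite -big_split; apply: eq_bigr => B _ /=.
by rewrite gaddE mulrDl mulrDr.
Qed.

Let gmulDr : right_distributive (@gmul) +%R.
Proof.
move=> a b c; apply/grassmannP => S; rewrite gaddE !gmkE -big_split.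
apply: eq_bigr => A _; rewrite -big_split; apply: eq_bigr => B _ /=.
by rewrite gaddE mulrDr mulrDr.
Qed.

HB.instance Definition _ :=
  GRing.Zmodule_isPzRing.Build grassmann gmulA gmul1l gmul1r gmulDl gmulDr.

Lemma gmulE a b S :
  (a * b) S = \sum_A \sum_(B | A :|: B == S) geps A B * (a A * b B).
Proof. exact: gmkE. Qed.

Lemma goneE S : (1 : grassmann) S = (S == set0)%:R. Proof. exact: gmkE. Qed.

(* K may be the zero ring, so grassmann cannot be an algType, which requires
   1 != 0; its K-algebra structure is the ring and K-module structures together
   with the next two lemmas. *)
Lemma gscaleAl k a b : k *: (a * b) = k *: a * b.
Proof.
apply/grassmannP => S; rewrite gscaleE !gmulE mulr_sumr; apply: eq_bigr => A _.
by rewrite mulr_sumr; apply: eq_bigr => B _; rewrite gscaleE mulrCA -mulrA.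
Qed.

Lemma gscaleAr k a b : k *: (a * b) = a * (k *: b).
Proof.
apply/grassmannP => S; rewrite gscaleE !gmulE mulr_sumr; apply: eq_bigr => A _.
rewrite mulr_sumr; apply: eq_bigr => B _.
by rewrite gscaleE mulrCA; congr (_ * _); rewrite mulrCA.
Qed.

(* gmon S is x^alpha, for S the support of alpha, and gvar i is x_i. By gmon_sum
   the monomials form a K-basis, and by gmon_prod they are the ordered products
   of the x_i, so the relations gvar_sqr and gvarM determine the product. *)
Definition gmon S := gmk (fun T => (T == S)%:R).
Definition gvar i := gmon [set i].

Lemma gmonE S T : gmon S T = (T == S)%:R. Proof. exact: gmkE. Qed.

Lemma gmon0 : gmon set0 = 1. Proof. by []. Qed.

Lemma gmon_sum a : a = \sum_S a S *: gmon S.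
Proof.
apply/grassmannP => T; rewrite gsumE (bigD1 T) //= big1 => [|S /negPf ST].
  by rewrite gscaleE gmonE eqxx mulr1 addr0.
by rewrite gscaleE gmonE eq_sym ST mulr0.
Qed.

Lemma gmonM A B : gmon A * gmon B = geps A B *: gmon (A :|: B).
Proof.
apply/grassmannP => S; rewrite gmulE gscaleE gmonE.
rewrite (bigD1 A) //= [X in _ + X]big1 ?addr0 => [|A' /negPf AA']; last first.
  by rewrite big1 // => B' _; rewrite !gmonE AA' mul0r mulr0.
rewrite big_mkcond (bigD1 B) //= big1 ?addr0 => [|B' /negPf BB']; last first.
  by rewrite !gmonE BB' !mulr0; case: ifP.
by rewrite !gmonE !eqxx !mulr1 eq_sym; case: ifP; rewrite ?mulr1 ?mulr0.
Qed.

Lemma gvar_sqr i : gvar i * gvar i = 0.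
Proof. by rewrite gmonM /geps disjoints1 set11 /= scale0r. Qed.

Lemma ninv11 i j : ninv [set i] [set j] = (j < i)%N.
Proof. by rewrite /ninv !big_set1. Qed.

Lemma gvarM i j : i != j -> gvar i * gvar j = - (gvar j * gvar i).
Proof.
move=> ij; rewrite !gmonM /geps !disjoints1 !inE (eq_sym j) ij.
rewrite !ninv11 setUC -scaleNr; congr (_ *: _).
by move: ij; rewrite -val_eqE /=; case: ltngtP => //= _ _; rewrite ?opprK.
Qed.

Lemma gmon_prod S : gmon S = \prod_(i < n | i \in S) gvar i.
Proof.
have lt_trans : transitive (fun i j : 'I_n => i < j)%N.
  by move=> x y z; apply: ltn_trans.
suff H r : sorted (fun i j : 'I_n => i < j)%N r ->
    \prod_(i <- r) gvar i = gmon [set i in r].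
  rewrite -big_filter [index_enum _]unlock -enumT H.
    by congr gmon; apply/setP => i; rewrite inE mem_filter mem_enum andbT.
  rewrite sorted_filter //.
  by have := iota_ltn_sorted 0 n; rewrite -val_enum_ord sorted_map.
elim: r => [|i r IH] r_sorted.
  by rewrite big_nil -gmon0; congr gmon; apply/setP => i; rewrite !inE.
rewrite big_cons IH ?(path_sorted r_sorted) //.
have /allP ltir := order_path_min lt_trans r_sorted.
have iNr : i \notin r by apply/negP => /ltir; rewrite ltnn.
rewrite gmonM /geps disjoints1 inE iNr /ninv big_set1.
rewrite big1 ?expr0 ?scale1r => [|j]; last first.
  by rewrite inE => /ltir ij; rewrite ltnNge ltnW.
by congr gmon; apply/setP => j; rewrite !inE.
Qed.

Lemma ninvC A B : [disjoint A & B] -> (ninv A B + ninv B A = #|A| * #|B|)%N.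
Proof.
move=> dAB; rewrite /ninv [X in (_ + X)%N]exchange_big -big_split /=.
rewrite -sum_nat_const; apply: eq_bigr => i iA; rewrite -big_split /=.
rewrite -sum1_card; apply: eq_bigr => j jB.
have: i != j by apply: contraTneq jB => <-; rewrite (disjointFr dAB).
by rewrite -val_eqE /=; case: ltngtP.
Qed.

Lemma geps_sym A B : geps A B = (-1) ^+ (#|A| * #|B|) * geps B A.
Proof.
rewrite /geps disjoint_sym; case: ifP => dBA; last by rewrite mulr0.
rewrite -ninvC 1?disjoint_sym // exprD -mulrA -expr2 -exprM.
by rewrite mulnC exprM sqrrN !expr1n mulr1.
Qed.

(* The K-submodule spanned by the x^S with P S. *)
Definition gspan (P : pred {set 'I_n}) : {pred grassmann} :=
  fun a => [forall S, (a S != 0) ==> P S].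

Lemma gspan0P (P : pred {set 'I_n}) a :
  reflect (forall S, ~~ P S -> a S = 0) (a \in gspan P).
Proof.
apply: (iffP forallP) => aP S.
  by move=> /negPf PS; apply/eqP; have := aP S; rewrite PS implybF negbK.
by apply/implyP; apply: contra_neqT => /aP.
Qed.

Lemma gspanP (P : pred {set 'I_n}) a :
  reflect (exists c : {set 'I_n} -> K, a = \sum_(S | P S) c S *: gmon S)
          (a \in gspan P).
Proof.
apply: (iffP (gspan0P P a)) => [aP|[c ->] S PS].
  exists a; rewrite {1}[a]gmon_sum [RHS]big_mkcond; apply: eq_bigr => S _.
  by case: ifP => // /negbT /aP ->; rewrite scale0r.
rewrite gsumE big1 // => T PT; rewrite gscaleE gmonE.
by case: eqP PS PT => [->/negPf->|]; rewrite ?mulr0.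
Qed.

Fact gspan_submod_closed P : submod_closed (gspan P).
Proof.
split=> [|k a b /gspan0P aP /gspan0P bP]; apply/gspan0P => S PS.
  by rewrite gzeroE.
by rewrite gaddE gscaleE aP // bP // mulr0 addr0.
Qed.
HB.instance Definition _ P :=
  GRing.isSubmodClosed.Build K grassmann (gspan P) (gspan_submod_closed P).

Lemma gspanM (P Q R : pred {set 'I_n}) a b :
    (forall A B, [disjoint A & B] -> P A -> Q B -> R (A :|: B)) ->
  a \in gspan P -> b \in gspan Q -> a * b \in gspan R.
Proof.
move=> PQR /gspan0P aP /gspan0P bQ; apply/gspan0P => S RS.
rewrite gmulE big1 // => A _; rewrite big1 // => B /eqP eS.
have [PA|/aP->] := boolP (P A); last by rewrite mul0r mulr0.
have [QB|/bQ->] := boolP (Q B); last by rewrite !mulr0.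
rewrite /geps; case: ifP => dAB; last by rewrite mul0r.
by move: RS; rewrite -eS PQR.
Qed.

(* gpar false is Lambda_n^ev and gpar true is Lambda_n^od. *)
Definition gpar (s : bool) := gspan (fun S => odd #|S| == s).
HB.instance Definition _ s := GRing.SubmodClosed.on (gpar s).

(* Lambda'_n^ev *)
Definition gev' := gspan (fun S => ~~ odd #|S| && (odd n || (S != [set: 'I_n]))).
HB.instance Definition _ := GRing.SubmodClosed.on gev'.

Lemma gparM s t a b : a \in gpar s -> b \in gpar t -> a * b \in gpar (s (+) t).
Proof.
apply: gspanM => A B dAB /eqP <- /eqP <-.
by rewrite cardsU (disjoint_setI0 dAB) cards0 subn0 oddD.
Qed.

Lemma gpar1 : 1 \in gpar false.
Proof.
apply/gspan0P => S; rewrite goneE; case: (S =P set0) => [->|//].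
by rewrite cards0.
Qed.

Lemma gvar_par i : gvar i \in gpar true.
Proof.
apply/gspan0P => S; rewrite gmonE; case: (S =P [set i]) => [->|//].
by rewrite cards1.
Qed.

(* The K-linear involution which is b |-> (-1)^s b on gpar s. *)
Definition ginvol b := gmk (fun S => (-1) ^+ #|S| * b S).

Lemma ginvolE b S : ginvol b S = (-1) ^+ #|S| * b S. Proof. exact: gmkE. Qed.

Lemma ginvol_par s b : b \in gpar s -> ginvol b = (-1) ^+ s * b.
Proof.
move=> /gspan0P bs; have -> : (-1) ^+ s * b = (-1) ^+ s *: b.
  by case: s {bs}; rewrite ?expr0 ?expr1 ?mul1r ?scale1r ?mulN1r ?scaleN1r.
apply/grassmannP => S; rewrite ginvolE gscaleE -signr_odd.
by have [/eqP->//|/bs->] := boolP (odd #|S| == s); rewrite !mulr0.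
Qed.

Lemma ginvol_linear : linear ginvol.
Proof.
move=> k a b; apply/grassmannP => S.
by rewrite gaddE gscaleE !ginvolE gaddE gscaleE mulrDr mulrCA.
Qed.
HB.instance Definition _ := GRing.isLinear.Build K _ _ _ _ ginvol_linear.

Lemma ginvolK : involutive ginvol.
Proof.
move=> a; apply/grassmannP => S.
by rewrite !ginvolE mulrA -expr2 sqrr_sign mul1r.
Qed.

Lemma ginvolM a b : ginvol (a * b) = ginvol a * ginvol b.
Proof.
apply/grassmannP => S; rewrite ginvolE !gmulE mulr_sumr; apply: eq_bigr => A _.
rewrite mulr_sumr; apply: eq_bigr => B /eqP <-; rewrite !ginvolE.
rewrite /geps; case: ifP => dAB; last by rewrite !mul0r mulr0.
rewrite cardsU (disjoint_setI0 dAB) cards0 subn0 exprD mulrCA.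
by rewrite mulrACA.
Qed.

Lemma gcommE s a b :
  a \in gpar s -> a * b = (if s then ginvol b else b) * a.
Proof.
move=> /gspan0P as_; apply/grassmannP => S; rewrite !gmulE.
under eq_bigr do rewrite big_mkcond.
under [RHS]eq_bigr do rewrite big_mkcond.
rewrite [RHS]exchange_big; apply: eq_bigr => A _; apply: eq_bigr => B _ /=.
rewrite setUC; case: ifP => // _.
have [/eqP sA|/as_->] := boolP (odd #|A| == s); last by rewrite mul0r !mulr0.
rewrite geps_sym -signr_odd oddM sA.
case: (s) => /=; last by rewrite expr0 mul1r [a A * _]mulrC.
by rewrite ginvolE signr_odd -!mulrA mulrCA [a A * _]mulrC.
Qed.

End GrassmannDef.

Arguments gzero {K n}.
Arguments gvar {K n} i.
Arguments gmon {K n} S.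
Arguments gpar {K n} s.
Arguments gev' {K n}.

Section EvenPart.
Variables (K : comPzRingType) (n : nat).

Record gev := Gev { gev_val : grassmann K n; gev_valP : gev_val \in gpar false }.

HB.instance Definition _ := [isSub for gev_val].
HB.instance Definition _ := [Choice of gev by <:].

Fact gev_subring_closed : subring_closed (@gpar K n false).
Proof.
by split=> [|a b|a b] *; [exact: gpar1|exact: rpredB|exact: (@gparM _ _ false false)].
Qed.
HB.instance Definition _ :=
  GRing.SubChoice_isSubPzRing.Build _ _ gev gev_subring_closed.

End EvenPart.

Section SkewDerivations.
Variables (K : comPzRingType) (n : nat).
Local Notation L := (grassmann K n).
Implicit Types (a b c : L) (d : L -> L) (r : gev K n) (i j : 'I_n).

Definition skew_derivation d :=
  linear d /\
  forall (s t : bool) a b, a \in gpar s -> b \in gpar t ->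
    d (a * b) = d a * b + (-1) ^+ s * (a * d b).

Lemma gpar_decomp a : exists a0 a1,
  [/\ a0 \in gpar false, a1 \in gpar true & a = a0 + a1].
Proof.
pose p s := gmk (fun S => if odd #|S| == s then a S else 0).
have pP s : p s \in gpar s.
  by apply/gspan0P => S /negPf Ss; rewrite gmkE Ss.
exists (p false), (p true); split => //.
by apply/grassmannP => S; rewrite gaddE !gmkE; case: odd; rewrite ?addr0 ?add0r.
Qed.

Lemma skew_derivationP d :
  skew_derivation d <->
  linear d /\ forall a b, d (a * b) = d a * b + ginvol a * d b.
Proof.
split=> -[dlin dM]; split=> //; last first.
  by move=> s t a b aP bP; rewrite dM (ginvol_par aP) mulrA.
pose dL := HB.pack_for {linear L -> L} d (GRing.isLinear.Build K _ _ _ d dlin).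
have dD x y : d (x + y) = d x + d y by exact: (raddfD dL).
move=> a b; have [a0 [a1 [a0P a1P ->]]] := gpar_decomp a.
have [b0 [b1 [b0P b1P ->]]] := gpar_decomp b.
rewrite (linearD (@ginvol K n)) !(mulrDl, mulrDr) !dD !(mulrDl, mulrDr).
rewrite (dM _ _ _ _ a0P b0P) (dM _ _ _ _ a0P b1P).
rewrite (dM _ _ _ _ a1P b0P) (dM _ _ _ _ a1P b1P).
rewrite /= (ginvol_par a0P) (ginvol_par a1P) !mulrA.
rewrite [X in X + _ = _]addrACA [X in _ + X = _]addrACA [LHS]addrACA.
by congr (_ + _); rewrite addrACA.
Qed.

(* sder is SDer_K(Lambda_n); it is a left module over gev = Lambda_n^ev. *)
Definition sder_pred : {pred L -> L} := fun d => `[< skew_derivation d >].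

Record sder := SDer { sder_fun :> L -> L; sderP : sder_fun \in sder_pred }.

HB.instance Definition _ := [isSub for sder_fun].
HB.instance Definition _ := [Choice of sder by <:].

Lemma sder_skew (D : sder) : skew_derivation D.
Proof. exact/asboolP/sderP. Qed.

HB.instance Definition _ (D : sder) :=
  GRing.isLinear.Build K L L _ (sder_fun D) (proj1 (sder_skew D)).

Lemma sderM (D : sder) a b : D (a * b) = D a * b + ginvol a * D b.
Proof. by have /skew_derivationP[_] := sder_skew D; apply. Qed.

Lemma sder_ext (D E : sder) : (forall a, D a = E a) -> D = E.
Proof. by move=> DE; apply/val_inj/funext. Qed.

Fact sder_zmod_closed : zmod_closed sder_pred.
Proof.
split=> [|d e /asboolP/skew_derivationP[dL dM] /asboolP/skew_derivationP[eL eM]];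
  apply/asboolP/skew_derivationP; split.
- by move=> k a b; rewrite scaler0 addr0.
- by move=> a b; rewrite mul0r mulr0 addr0.
- by move=> k a b; rewrite !fctE dL eL scalerBr opprD addrACA.
- by move=> a b; rewrite !fctE dM eM mulrBl mulrBr opprD addrACA.
Qed.
HB.instance Definition _ :=
  GRing.SubChoice_isSubZmodule.Build _ _ sder sder_zmod_closed.

Fact sder_scale_subproof r (D : sder) :
  (fun a => gev_val r * D a) \in sder_pred.
Proof.
apply/asboolP/skew_derivationP; split=> [k a b|a b].
  by rewrite linearP mulrDr gscaleAr.
by rewrite sderM mulrDr !mulrA (gcommE (ginvol a) (gev_valP r)).
Qed.
Definition sder_scale r D := SDer (sder_scale_subproof r D).

Fact sder_scaleA r s D : sder_scale r (sder_scale s D) = sder_scale (r * s) D.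
Proof. by apply: sder_ext => a /=; rewrite mulrA. Qed.
Fact sder_scale1 : left_id 1 sder_scale.
Proof. by move=> D; apply: sder_ext => a /=; rewrite mul1r. Qed.
Fact sder_scaleDr : right_distributive sder_scale +%R.
Proof. by move=> r D E; apply: sder_ext => a /=; rewrite mulrDr. Qed.
Fact sder_scaleDl D : {morph sder_scale^~ D : r s / r + s}.
Proof. by move=> r s; apply: sder_ext => a /=; rewrite mulrDl. Qed.
HB.instance Definition _ := GRing.Zmodule_isLmodule.Build (gev K n) sder
  sder_scaleA sder_scale1 sder_scaleDr sder_scaleDl.

Implicit Types (D E : sder).

Lemma sder_addE D E a : (D + E) a = D a + E a. Proof. by []. Qed.
Lemma sder_scaleE r D a : (r *: D) a = gev_val r * D a. Proof. by []. Qed.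
Lemma sder_zeroE a : (0 : sder) a = 0. Proof. by []. Qed.

(* sder_par false is SDer^ev and sder_par true is SDer^od. *)
Definition sder_par (p : bool) : {pred sder} :=
  fun D => `[< forall s a, a \in gpar s -> D a \in gpar (s (+) p) >].

Fact sder_par_submod_closed p : submod_closed (sder_par p).
Proof.
split=> [|r D E /asboolP DP /asboolP EP]; apply/asboolP => s a aP.
  by rewrite sder_zeroE rpred0.
rewrite sder_addE sder_scaleE rpredD ?EP //.
exact: (gparM (gev_valP r) (DP _ _ aP)).
Qed.
HB.instance Definition _ p :=
  GRing.isSubmodClosed.Build _ _ (sder_par p) (sder_par_submod_closed p).

Record sder_od := SDerOd { sder_od_val :> sder; _ : sder_od_val \in sder_par true }.

HB.instance Definition _ := [isSub for sder_od_val].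
HB.instance Definition _ := [Choice of sder_od by <:].
HB.instance Definition _ := GRing.SubChoice_isSubLmodule.Build _ _ _ sder_od
  (sder_par_submod_closed true).

(* Since ginvol b = (-1)^s b for b in gpar s, this is the K-linear map sending
   such a b to a b - (-1)^s b a. *)
Definition sad_fun a : L -> L := fun b => a * b - ginvol b * a.

Lemma sad_funE s a b : b \in gpar s ->
  sad_fun a b = a * b - (-1) ^+ s * (b * a).
Proof. by move=> bs; rewrite /sad_fun (ginvol_par bs) mulrA. Qed.

Fact sad_subproof a : sad_fun a \in sder_pred.
Proof.
apply/asboolP/skew_derivationP; split=> [k b c|b c]; rewrite /sad_fun.
  rewrite linearP mulrDr mulrDl opprD -gscaleAr -gscaleAl addrACA.
  by rewrite -scalerBr.
by rewrite ginvolM mulrBl mulrBr !mulrA subrKA.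
Qed.
Definition sad a : sder := SDer (sad_subproof a).

(* ISDer_K(Lambda_n) *)
Definition isder : {pred sder} := fun D => `[< exists a, D = sad a >].

Fact isder_submod_closed : submod_closed isder.
Proof.
split=> [|r D E /asboolP[a ->] /asboolP[b ->]]; apply/asboolP.
  by exists 0; apply: sder_ext => b /=; rewrite /sad_fun mul0r mulr0 subr0.
exists (gev_val r * a + b); apply: sder_ext => c.
rewrite sder_addE sder_scaleE /= /sad_fun mulrDl [ginvol c * (_ + _)]mulrDr opprD addrACA.
congr (_ + _).
by rewrite mulrBr !mulrA (gcommE (ginvol c) (gev_valP r)).
Qed.
HB.instance Definition _ :=
  GRing.isSubmodClosed.Build _ _ isder isder_submod_closed.

(* The left partial derivative: partial_i x^S = 0 if i is not in S, and
   partial_i (x_i x^T) = x^T if i is not in T. *)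
Definition partial_fun i : L -> L :=
  fun b => gmk (fun T => geps K [set i] T * b (i |: T)).

Lemma partial_funE i b T : partial_fun i b T = geps K [set i] T * b (i |: T).
Proof. exact: gmkE. Qed.

Lemma partial_linear i : linear (partial_fun i).
Proof.
move=> k a b; apply/grassmannP => S.
by rewrite gaddE gscaleE !partial_funE gaddE gscaleE mulrDr mulrCA.
Qed.
HB.instance Definition _ i :=
  GRing.isLinear.Build K L L _ (partial_fun i) (partial_linear i).

Let free i : {pred L} := gspan (fun S => i \notin S).

Let freeP i a : reflect (forall S : {set _}, i \in S -> a S = 0) (a \in free i).
Proof.
by apply: (iffP (gspan0P _ _)) => aP S; have := aP S; rewrite negbK.
Qed.

Let geps1_in i (S : {set 'I_n}) : i \in S -> geps K [set i] S = 0.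
Proof. by rewrite /geps disjoints1 => ->. Qed.

Let geps1_sqr i (S : {set 'I_n}) :
  i \notin S -> geps K [set i] S * geps K [set i] S = 1.
Proof. by rewrite /geps disjoints1 => ->; rewrite -expr2 sqrr_sign. Qed.

Let gvar_mulE i a S : (gvar i * a) S =
  if i \in S then geps K [set i] (S :\ i) * a (S :\ i) else 0.
Proof.
rewrite gmulE (bigD1 [set i]) //= [X in _ + X]big1 ?addr0; last first.
  by move=> A /negPf Ai; rewrite big1 // => B _; rewrite gmonE Ai mul0r mulr0.
case: ifPn => iS; last first.
  rewrite big_pred0 // => B; apply: contraNF iS => /eqP <-.
  by rewrite !inE eqxx.
rewrite (bigD1 (S :\ i)) ?setD1K //= gmonE eqxx mul1r big1 ?addr0 //.
move=> B /andP[/eqP eS BS]; rewrite geps1_in ?mul0r //.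
by apply: contraNT BS => iB; rewrite -eS setU1K.
Qed.

Let partial_free i a : partial_fun i a \in free i.
Proof.
by apply/freeP => S iS; rewrite partial_funE geps1_in ?mul0r.
Qed.

Let partial_decomp i a :
  exists2 u, u \in free i & a = u + gvar i * partial_fun i a.
Proof.
exists (gmk (fun S => if i \in S then 0 else a S)).
  by apply/freeP => S iS; rewrite gmkE iS.
apply/grassmannP => S; rewrite gaddE gmkE gvar_mulE.
case: ifPn => iS; last by rewrite addr0.
by rewrite partial_funE mulrA geps1_sqr ?setD11 // mul1r setD1K // add0r.
Qed.

Let partial_free0 i u : u \in free i -> partial_fun i u = 0.
Proof.
move=> /freeP uP; apply/grassmannP => S.
by rewrite gzeroE partial_funE uP ?setU11 // mulr0.
Qed.

Let partial_var i w : w \in free i -> partial_fun i (gvar i * w) = w.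
Proof.
move=> /freeP wP; apply/grassmannP => S; rewrite partial_funE gvar_mulE setU11.
have [iS|iS] := boolP (i \in S); first by rewrite (wP S iS) (geps1_in iS) mul0r.
by rewrite setU1K // mulrA geps1_sqr // mul1r.
Qed.

Let freeM i u w : u \in free i -> w \in free i -> u * w \in free i.
Proof. by apply: gspanM => A B _ iA iB; rewrite inE negb_or iA. Qed.

Let free_ginvol i u : u \in free i -> ginvol u \in free i.
Proof. by move=> /freeP uP; apply/freeP => S iS; rewrite ginvolE uP ?mulr0. Qed.

Fact partial_subproof i : partial_fun i \in sder_pred.
Proof.
apply/asboolP/skew_derivationP; split=> [|a b]; first exact: partial_linear.
set v := partial_fun i a; set w := partial_fun i b.
have [u uF ea] := partial_decomp i a; have [t tF eb] := partial_decomp i b.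
have vF : v \in free i := partial_free i a.
have wF : w \in free i := partial_free i b.
rewrite -/v in ea; rewrite -/w in eb.
have xC c : gvar i * c = ginvol c * gvar i by exact: gcommE (gvar_par K i).
have Cx c : c * gvar i = gvar i * ginvol c by rewrite xC ginvolK.
have xcx c : gvar i * c * gvar i = 0 by rewrite xC -mulrA gvar_sqr mulr0.
have xI : ginvol (gvar i : L) = - gvar i.
  by rewrite (ginvol_par (gvar_par K i)) mulN1r.
have -> : a * b = u * t + gvar i * (v * t + ginvol u * w).
  rewrite ea eb mulrDl !mulrDr !mulrA xcx mul0r addr0 (Cx u).
  by rewrite -!addrA; congr (_ + _); rewrite addrC.
rewrite raddfD /= partial_free0 ?freeM // add0r partial_var; last first.
  by rewrite rpredD // freeM // free_ginvol.
rewrite eb ea (raddfD (@ginvol K n)) /= ginvolM xI.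
rewrite mulNr -Cx mulrDr mulrDl mulNr mulrA.
by rewrite [_ - v * _ * w]addrC addrA addrK.
Qed.

Definition partial i : sder := SDer (partial_subproof i).

Lemma partial_gvar i j : partial i (gvar j) = (i == j)%:R.
Proof.
apply/grassmannP => S; rewrite partial_funE gmonE.
case: (eqVneq i j) => [<-|/negPf ij] /=; last first.
  rewrite gzeroE; case: eqP => [eS|]; last by rewrite mulr0.
  by have := setU11 i S; rewrite eS inE ij.
rewrite goneE; case: (S =P set0) => [->|/eqP/set0Pn[k kS]].
  by rewrite geps0r setU0 eqxx mul1r.
case: eqP => [eS|]; last by rewrite mulr0.
have := setU1r i kS; rewrite eS inE => /eqP ki.
by rewrite geps1_in ?mul0r // -ki.
Qed.

(* A skew derivation is determined by its values on the generators; in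
   particular partial i is the only one mapping each gvar j to (i == j)%:R. *)
Lemma sder_gvar_ext (D E : sder) : (forall i, D (gvar i) = E (gvar i)) -> D = E.
Proof.
move=> DE; apply: sder_ext => a; rewrite (gmon_sum a) !linear_sum /=.
apply: eq_bigr => S _; rewrite !linearZ /=; congr (_ *: _).
have D1 (F : sder) : F 1 = 0.
  apply: (addrI (F 1)); rewrite addr0 -{3}[1]mulr1 sderM mulr1.
  by rewrite (ginvol_par (gpar1 K n)) expr0 mulr1 mul1r.
rewrite gmon_prod; elim/big_ind: _ => [|b c Db Dc|i _]; last exact: DE.
- by rewrite !D1.
- by rewrite !sderM Db Dc.
Qed.

(* Lambda_n^ev partial_i *)
Definition gev_partial i : {pred sder} :=
  fun D => `[< exists r, D = r *: partial i >].

End SkewDerivations.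

Section InternalDirectSum.
Variables (R : pzRingType) (M : lmodType R) (I : finType).

(* P is the internal direct sum of its R-submodules N i. *)
Definition internal_direct_sum (N : I -> {pred M}) (P : {pred M}) :=
  [/\ forall i, submod_closed (N i),
      forall u : I -> M, (forall i, u i \in N i) -> \sum_i u i \in P &
      forall m, m \in P ->
        exists! u : {ffun I -> M}, (forall i, u i \in N i) /\ m = \sum_i u i].

End InternalDirectSum.

Section LmodQuotient.
Variables (R : pzRingType) (M : lmodType R) (N : submodClosed M).
Local Open Scope quotient_scope.

Fact lmod_quot_zmod_closed : zmod_closed N.
Proof.
split=> [|x y xN yN]; first exact: rpred0.
by rewrite rpredD // -scaleN1r rpredZ.
Qed.

Definition lmod_quot_zmodClosed : zmodClosed M :=
  HB.pack_for (zmodClosed M) (N : {pred M})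
    (GRing.isZmodClosed.Build M (N : {pred M}) lmod_quot_zmod_closed).

(* The quotient M / N, with the R-module structure a *: \pi x = \pi (a *: x)
   on top of the additive quotient group of the library. *)
Definition lmod_quot := Quotient.quot lmod_quot_zmodClosed.
HB.instance Definition _ := GRing.Zmodule.on lmod_quot.
HB.instance Definition _ := EqQuotient.on lmod_quot.

Definition lmod_quot_pi (x : M) : lmod_quot := \pi x.

Definition lmod_quot_scale (a : R) (x : lmod_quot) := lmod_quot_pi (a *: repr x).

Lemma lmod_quot_piP (x y : M) :
  reflect (lmod_quot_pi x = lmod_quot_pi y) (x - y \in N).
Proof.
rewrite (Quotient.idealrBE lmod_quot_zmodClosed).
exact: eqP.
Qed.

Lemma lmod_quot_ind (P : lmod_quot -> Prop) :
  (forall x, P (lmod_quot_pi x)) -> forall x, P x.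
Proof. by move=> Ppi x; rewrite -[x]reprK; apply: Ppi. Qed.

Lemma lmod_quot_scaleE a (x : M) :
  lmod_quot_scale a (lmod_quot_pi x) = lmod_quot_pi (a *: x).
Proof.
apply/lmod_quot_piP; rewrite -scalerBr rpredZ //; apply/lmod_quot_piP.
exact: reprK.
Qed.

Lemma lmod_quot_piD (x y : M) :
  lmod_quot_pi (x + y) = lmod_quot_pi x + lmod_quot_pi y.
Proof. exact: (@Quotient.pi_add _ lmod_quot_zmodClosed). Qed.

Fact lmod_quot_scaleA a b x :
  lmod_quot_scale a (lmod_quot_scale b x) = lmod_quot_scale (a * b) x.
Proof. by elim/lmod_quot_ind: x => x; rewrite !lmod_quot_scaleE scalerA. Qed.
Fact lmod_quot_scale1 : left_id 1 lmod_quot_scale.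
Proof. by elim/lmod_quot_ind => x; rewrite !lmod_quot_scaleE scale1r. Qed.
Fact lmod_quot_scaleDr : right_distributive lmod_quot_scale +%R.
Proof.
move=> a; elim/lmod_quot_ind => x; elim/lmod_quot_ind => y.
by rewrite -lmod_quot_piD !lmod_quot_scaleE scalerDr lmod_quot_piD.
Qed.
Fact lmod_quot_scaleDl x : {morph lmod_quot_scale^~ x : a b / a + b}.
Proof.
move=> a b; elim/lmod_quot_ind: x => x.
by rewrite !lmod_quot_scaleE scalerDl lmod_quot_piD.
Qed.
HB.instance Definition _ := GRing.Zmodule_isLmodule.Build R lmod_quot
  lmod_quot_scaleA lmod_quot_scale1 lmod_quot_scaleDr lmod_quot_scaleDl.

Lemma lmod_quot_piZ a (x : M) : lmod_quot_pi (a *: x) = a *: lmod_quot_pi x.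
Proof. by rewrite -lmod_quot_scaleE. Qed.

End LmodQuotient.

Definition sder_quot (K : comPzRingType) (n : nat) :=
  lmod_quot (isder (K := K) (n := n)).
HB.instance Definition _ K n := GRing.Lmodule.on (sder_quot K n).

Arguments sad {K n}.
Arguments isder {K n}.
Arguments sder_par {K n}.
Arguments partial {K n}.
Arguments gev_partial {K n}.

(* Main.v *)
(* A skew derivation D is determined by its values u_i = D(x_i).  The even parts of
   the u_i give the odd derivation sum_i (u_i)^ev partial_i, so that D minus it has
   odd values on the x_i.  If all u_i are odd, applying D to x_i x_j + x_j x_i = 0
   and cancelling 2 gives x_j u_i = - x_i u_j; these relations force
   u_i = x_i a for a single even a, whose coefficients below the top degree are
   unique, and then D = sad(a/2).  The projection of D to its odd part therefore
   has kernel ISDer, which gives the statement on the quotient. *)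
From HB Require Import structures.
Require Import Defs.
From mathcomp Require Import all_boot all_order all_algebra.
From mathcomp Require Import classical_sets functions.

Local Open Scope ring_scope.
Local Open Scope classical_set_scope.

Import GRing.Theory boolp.

Set Implicit Arguments.
Unset Strict Implicit.
Unset Printing Implicit Defensive.

Section Grassmann.
Variables (K : comPzRingType) (n : nat).
Local Notation L := (grassmann K n).
Implicit Types (a b c : L) (S T : {set 'I_n}) (i j : 'I_n) (s : bool).
Implicit Types (r : gev K n) (D : sder K n).

Lemma sderN D a : D (- a) = - D a.
Proof. exact: linearN. Qed.

Lemma sderD D a b : D (a + b) = D a + D b.
Proof. exact: linearD. Qed.

(** * Parity components of elements *)

Lemma gpar_cap0 s a : a \in gpar s -> a \in gpar (~~ s) -> a = 0.
Proof.
move=> /gspan0P a0 /gspan0P a1; apply/grassmannP => S; rewrite gzeroE.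
have [/eqP Ss|/a0//] := boolP (odd #|S| == s).
by apply: a1; rewrite Ss; case: (s).
Qed.

Definition gpart s a : L := gmk (fun S => if odd #|S| == s then a S else 0).

Lemma gpart_par s a : gpart s a \in gpar s.
Proof. by apply/gspan0P => S /negPf Ss; rewrite gmkE Ss. Qed.

Lemma gpart_sum s a : a = gpart s a + gpart (~~ s) a.
Proof.
apply/grassmannP => S; rewrite gaddE !gmkE.
by case: s; case: odd; rewrite ?addr0 ?add0r.
Qed.

(** The parity decomposition is direct: [gpart s a - b] has both parities, hence vanishes. *)
Lemma gpart_uniq s a b : b \in gpar s -> a - b \in gpar (~~ s) -> gpart s a = b.
Proof.
move=> bs abs; apply/eqP; rewrite -subr_eq0; apply/eqP.
apply: (@gpar_cap0 s); first by rewrite rpredB ?gpart_par.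
have -> : gpart s a - b = (a - b) - gpart (~~ s) a.
  by rewrite {2}(gpart_sum s a) addrAC addrK.
by rewrite rpredB ?gpart_par.
Qed.

Lemma gpartD s a b : gpart s (a + b) = gpart s a + gpart s b.
Proof.
apply/grassmannP => S; rewrite !gaddE [LHS]gmkE gaddE.
by rewrite [gpart s a S]gmkE [gpart s b S]gmkE; case: ifP; rewrite ?addr0.
Qed.

Lemma gpart_gevM s r a : gpart s (gev_val r * a) = gev_val r * gpart s a.
Proof.
apply: gpart_uniq; first exact: (gparM (gev_valP r) (gpart_par s a)).
rewrite -mulrBr {1}(gpart_sum s a) addrAC subrr add0r.
exact: (gparM (gev_valP r) (gpart_par _ a)).
Qed.

(** * Multiplication by a generator, partial derivatives, [sad] *)

Lemma gvar_mul_free i a S : i \notin S -> (gvar i * a) S = 0.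
Proof.
move=> iS; have /gspan0P -> // : gvar i * a \in gspan (fun S => i \in S).
apply: (@gspanM _ _ (fun A : {set _} => i \in A) xpredT) => [A B _ iA _||].
- by rewrite inE iA.
- by apply/gspan0P => T; rewrite gmonE; case: eqP => // ->; rewrite set11.
- by apply/gspan0P.
Qed.

(** Every monomial of [a] contains x_i, so no pair of supports is disjoint and the product lies in
    the span of no monomials. *)
Lemma gvar_mul_eq0 i a : (forall S, i \notin S -> a S = 0) -> gvar i * a = 0.
Proof.
move=> aS; apply/grassmannP => S; rewrite gzeroE.
have /gspan0P -> // : gvar i * a \in gspan xpred0.
pose P (A : {set 'I_n}) := i \in A; apply: (@gspanM _ _ P P) => [A B||].
- by move=> /disjointFr dAB /dAB; rewrite /P => ->.
- by apply/gspan0P => T; rewrite gmonE /P; case: eqP => // ->; rewrite set11.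
- exact/gspan0P.
Qed.

Lemma partial_gvarM i j a :
  partial i (gvar j * a) = (i == j)%:R * a - gvar j * partial i a.
Proof.
rewrite sderM partial_gvar (ginvol_par (gvar_par K j)).
by rewrite expr1 mulN1r mulNr.
Qed.

Lemma partial_gvarM_free i a S : i \notin S -> partial i (gvar i * a) S = a S.
Proof.
move=> iS; rewrite partial_gvarM eqxx mul1r gaddE goppE.
by rewrite gvar_mul_free // subr0.
Qed.

Lemma partial_par i : partial i \in @sder_par K n true.
Proof.
apply/asboolP => s a /gspan0P aP; apply/gspan0P => S oS.
rewrite partial_funE /geps disjoints1; case: ifP; last by rewrite mul0r.
move=> iS; rewrite aP ?mulr0 // cardsU1 iS.
by move: oS; rewrite /= add0n; case: s {aP}; case: odd.
Qed.

Lemma sad_par a : a \in gpar false -> sad a \in sder_par false.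
Proof.
move=> aP; apply/asboolP => s b bP /=; rewrite (sad_funE _ bP) addbF.
rewrite rpredB ?(gparM aP bP) //.
have := gparM bP aP; rewrite addbF => baP.
by case: s {bP} baP; rewrite ?mulN1r ?mul1r ?rpredN.
Qed.

(** An odd [a] satisfies a b = [ginvol b] a for every b, so only the even part of an element matters
    to [sad]. *)
Lemma sad_od a : a \in gpar true -> sad a = 0.
Proof.
by move=> aP; apply: sder_ext => b /=; rewrite /sad_fun (gcommE b aP) subrr.
Qed.

Lemma sadD a b : sad (a + b) = sad a + sad b.
Proof.
apply: sder_ext => c; rewrite sder_addE /= /sad_fun mulrDl mulrDr opprD.
by rewrite addrACA.
Qed.

Lemma sad_gvar a i : a \in gpar false -> sad a (gvar i) = gvar i * a *+ 2.
Proof.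
move=> aP /=; rewrite (sad_funE _ (gvar_par K i)) expr1 mulN1r opprK.
by rewrite (gcommE _ aP).
Qed.

Lemma gev'_even a : a \in gev' -> a \in gpar false.
Proof.
move=> /gspan0P aP; apply/gspan0P => S oS; apply: aP.
by move: oS; case: odd.
Qed.

(** * The odd component of a skew derivation *)

Definition gev_part a : gev K n := Gev (gpart_par false a).

Definition sder_odpart D : sder K n :=
  \sum_i gev_part (D (gvar i)) *: partial i.

Lemma sder_sumE (I : Type) (t : seq I) (P : pred I) (F : I -> sder K n) a :
  (\sum_(i <- t | P i) F i) a = \sum_(i <- t | P i) F i a.
Proof. by elim/big_rec2: _ => // i x y _ <-. Qed.

Lemma gev_partial_sum_gvar (c : 'I_n -> gev K n) j :
  (\sum_i c i *: partial i) (gvar j) = gev_val (c j).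
Proof.
rewrite sder_sumE (bigD1 j) //= big1 => [|i /negPf ij].
  by rewrite addr0 [X in _ * X](partial_gvar K) eqxx mulr1.
by rewrite [X in _ * X](partial_gvar K) ij mulr0.
Qed.

Lemma sder_odpart_gvar D j : sder_odpart D (gvar j) = gpart false (D (gvar j)).
Proof. exact: gev_partial_sum_gvar. Qed.

Lemma sder_odpart_par D : sder_odpart D \in sder_par true.
Proof.
by apply: rpred_sum => i _; apply: rpredZ; apply: partial_par.
Qed.

Lemma sder_odpart_id D : D \in sder_par true -> sder_odpart D = D.
Proof.
move=> /asboolP DP; apply: sder_gvar_ext => i; rewrite sder_odpart_gvar.
have Dx := DP _ _ (gvar_par K i).
by apply: gpart_uniq; rewrite ?subrr ?rpred0.
Qed.

Lemma sder_odpart_ev D : D \in sder_par false -> sder_odpart D = 0.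
Proof.
move=> /asboolP DP; apply: sder_gvar_ext => i; rewrite sder_odpart_gvar.
by apply: gpart_uniq; rewrite ?rpred0 // subr0; apply: DP (gvar_par K i).
Qed.

(** Values on generators determine a derivation, and multiplying by an even element commutes with
    taking parity components. *)
Lemma sder_odpart_linear : linear sder_odpart.
Proof.
move=> r D E; apply: sder_gvar_ext => i.
rewrite sder_addE sder_scaleE !sder_odpart_gvar.
by rewrite sder_addE sder_scaleE gpartD gpart_gevM.
Qed.

Lemma isderE D : reflect (exists2 a, a \in gpar false & D = sad a) (D \in isder).
Proof.
apply: (iffP (asboolP _)) => [[a ->]|[a _ ->]]; last by exists a.
exists (gpart false a); first exact: gpart_par.
by rewrite {1}(gpart_sum false a) sadD (sad_od (gpart_par true a)) addr0.
Qed.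

Lemma isder_par D : D \in isder -> D \in sder_par false.
Proof. by move=> /isderE[a aP ->]; apply: sad_par. Qed.

(** * Skew derivations with odd values on the generators *)

Section Half.
Variables (h : K) (hE : 2%:R * h = 1).

Lemma double_eq0 a : a *+ 2 = 0 -> a = 0.
Proof.
by move=> a0; rewrite -[a]scale1r -hE mulrC -scalerA scaler_nat a0 scaler0.
Qed.

(* The relation x_i x_j + x_j x_i = 0 under D, with 2 cancelled. *)
Lemma sder_gvar_rel D i j : (forall k, D (gvar k) \in gpar true) ->
  gvar j * D (gvar i) = - (gvar i * D (gvar j)).
Proof.
move=> DP; apply/eqP; rewrite -addr_eq0; apply/eqP.
set z := _ + _; apply: double_eq0.
have xx : gvar i * gvar j + gvar j * gvar i = 0 :> L.
  have [->|ij] := eqVneq i j; first by rewrite gvar_sqr addr0.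
  by rewrite (gvarM _ ij) addNr.
have := congr1 D xx; rewrite sderD linear0 !sderM.
rewrite !(ginvol_par (gvar_par K _)) expr1 !mulN1r !mulNr.
(* Both factors are odd, so they anticommute; the Leibniz expansion then collapses to -(z + z). *)
have Dx k l : D (gvar k) * gvar l = - (gvar l * D (gvar k)).
  by rewrite (gcommE _ (DP k)) (ginvol_par (gvar_par K l)) expr1 mulN1r mulNr.
rewrite !Dx => /eqP; rewrite -!opprD oppr_eq0 => /eqP <-.
by rewrite /z mulr2n; congr (_ + _); rewrite addrC.
Qed.

End Half.

(* A compatible family u_i is x_i * a, where the coefficient of x^T in a can be
   read off partial_i u_i for any i not in T. *)
Section Glue.
Variables (u : 'I_n -> L) (uu : forall i, gvar i * u i = 0).
Hypothesis uC : forall i j, gvar j * u i = - (gvar i * u j).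

Lemma glueE i : u i = gvar i * partial i (u i).
Proof.
have := congr1 (partial i) (uu i); rewrite linear0 partial_gvarM eqxx mul1r.
by move/eqP; rewrite subr_eq0 => /eqP.
Qed.

(** Applying partial_j to x_j u_i = - x_i u_j expresses u_i as x_j partial_j u_i + x_i partial_j
    u_j. After partial_i, the first term stays divisible by x_j and so does not reach x^T. *)
Lemma partial_glue i j T :
  i \notin T -> j \notin T -> partial i (u i) T = partial j (u j) T.
Proof.
have [<-//|/negPf ij] := eqVneq i j; move=> iT jT.
have ui : u i = gvar j * partial j (u i) + gvar i * partial j (u j).
  have := congr1 (partial j) (uC i j); rewrite sderN !partial_gvarM eqxx.
  rewrite eq_sym ij mul1r mul0r sub0r opprK => /eqP.
  by rewrite subr_eq addrC => /eqP.
rewrite {1}ui sderD gaddE partial_gvarM_free // partial_gvarM ij.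
by rewrite mul0r sub0r goppE gvar_mul_free // oppr0 add0r.
Qed.

(** The default 0 concerns only the top monomial, which every x_i kills; it is what places [glue] in
    [gev']. *)
Definition glue : L :=
  gmk (fun T => if [pick i | i \notin T] is Some i then partial i (u i) T else 0).

Lemma glue_coef i T : i \notin T -> glue T = partial i (u i) T.
Proof.
move=> iT; rewrite gmkE; case: pickP => [j jT|/(_ i)]; last by rewrite iT.
exact: partial_glue.
Qed.

Lemma gvar_glue i : gvar i * glue = u i.
Proof.
rewrite glueE; apply/eqP; rewrite -subr_eq0 -mulrBr; apply/eqP.
(* The two cofactors of x_i may differ only on monomials containing x_i. *)
apply: gvar_mul_eq0 => S iS.
by rewrite gaddE goppE (glue_coef iS) subrr.
Qed.

Lemma glue_ev' : (forall i, u i \in gpar true) -> glue \in gev'.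
Proof.
move=> uP; apply/gspan0P => T; rewrite gmkE; case: pickP => // i iT.
rewrite negb_and negb_or !negbK => /orP[oT|/andP[_ /eqP TT]]; last first.
  by move: iT; rewrite /= TT inE.
have /gspan0P -> // : partial i (u i) \in gpar false.
  by have /asboolP /(_ _ _ (uP i)) := partial_par i.
by rewrite oT.
Qed.

End Glue.

Lemma gvar_odd_sad D (h : K) : 2%:R * h = 1 ->
    (forall i, D (gvar i) \in gpar true) ->
  exists2 a, a \in gev' & D = sad a.
Proof.
move=> hE DP; pose u i := D (gvar i).
have uC i j : gvar j * u i = - (gvar i * u j) by apply: (sder_gvar_rel hE i j DP).
have uu i : gvar i * u i = 0.
  by apply: (double_eq0 hE); rewrite mulr2n {1}uC addNr.
(* The factor [h] cancels the 2 of [sad_gvar]. *)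
have aP : h *: glue u \in gev' by rewrite rpredZ // glue_ev'.
exists (h *: glue u) => //; apply: sder_gvar_ext => i.
rewrite sad_gvar ?gev'_even // -gscaleAr gvar_glue // -scaler_nat scalerA hE.
by rewrite scale1r.
Qed.

(** Subtracting the odd part leaves odd values on the generators, where [gvar_odd_sad] applies. *)
Lemma isder_odpart D (h : K) : 2%:R * h = 1 -> D - sder_odpart D \in isder.
Proof.
move=> hE; apply/asboolP.
have [|a _ ->] := @gvar_odd_sad (D - sder_odpart D) h hE; last by exists a.
move=> i; rewrite sder_addE (_ : (- sder_odpart D) _ = - gpart false (D (gvar i))).
  by rewrite {1}(gpart_sum false (D (gvar i))) addrAC subrr add0r gpart_par.
by rewrite -sder_odpart_gvar.
Qed.

Lemma isder_gev' (h : K) : 2%:R * h = 1 ->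
  [set` isder] = [set @sad K n a | a in [set` gev']].
Proof.
move=> hE; apply/seteqP; split=> [D /= /isder_par /asboolP DP | D /= [a _ <-]].
  have [i|a aP ->] := @gvar_odd_sad D h hE; last by exists a.
  exact: DP (gvar_par K i).
by apply/asboolP; exists a.
Qed.

Lemma sad_inj (h : K) : 2%:R * h = 1 ->
  set_inj [set` gev'] (@sad K n).
Proof.
move=> hE a b; rewrite !inE /= => aP bP sab.
apply/eqP; rewrite -subr_eq0; apply/eqP/grassmannP => S; rewrite gzeroE.
have cP : a - b \in gev' by rewrite rpredB.
have xc i : gvar i * (a - b) = 0.
  apply: (double_eq0 hE); rewrite mulrBr mulrnBl.
  by rewrite -!sad_gvar ?gev'_even // sab subrr.
have [i iS|S1] := pickP [pred i | i \notin S].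
  by rewrite -(partial_gvarM_free _ iS) xc linear0 gzeroE.
(* Only the top coefficient remains: for n odd it has the wrong parity, for n even [gev'] excludes
   it. *)
have eS : S = finset.setT by apply/setP => i; rewrite inE; exact: negbFE (S1 i).
by have /gspan0P -> // := cP; rewrite eS eqxx orbF cardsT card_ord; case: odd.
Qed.

Lemma sder_odpartD D E : sder_odpart (D + E) = sder_odpart D + sder_odpart E.
Proof. by have := sder_odpart_linear 1 D E; rewrite !scale1r. Qed.

Lemma gev_partial_submod_closed i : submod_closed (@gev_partial K n i).
Proof.
split=> [|r D E /asboolP[s ->] /asboolP[t ->]]; apply/asboolP.
  by exists 0; rewrite scale0r.
by exists (r * s + t); rewrite scalerDl scalerA.
Qed.

(** * The quotient by the inner skew derivations *)

Definition sder_to_od D : sder_od K n := SDerOd (sder_odpart_par D).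

Definition sder_quot_to_od (x : sder_quot K n) := sder_to_od (repr x).

(** Independence of the representative: two of them differ by an inner derivation, which is even and
    has zero odd part. *)
Lemma sder_quot_to_odE D : sder_quot_to_od (lmod_quot_pi isder D) = sder_to_od D.
Proof.
apply: val_inj => /=; set E := repr _.
have /isder_par/sder_odpart_ev : E - D \in isder.
  by apply/lmod_quot_piP; apply: reprK.
rewrite -scaleN1r addrC sder_odpart_linear scaleN1r addrC => /eqP.
by rewrite subr_eq0 => /eqP.
Qed.

Lemma sder_quot_to_od_linear : linear sder_quot_to_od.
Proof.
move=> r; elim/lmod_quot_ind => D; elim/lmod_quot_ind => E.
rewrite -lmod_quot_piZ -lmod_quot_piD !sder_quot_to_odE.
by apply: val_inj; rewrite /= sder_odpart_linear.
Qed.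

HB.instance Definition _ := GRing.isLinear.Build (gev K n) (sder_quot K n)
  (sder_od K n) _ sder_quot_to_od sder_quot_to_od_linear.

Lemma sder_quot_to_od_bij (h : K) : 2%:R * h = 1 -> bijective sder_quot_to_od.
Proof.
move=> hE; exists (fun D : sder_od K n => lmod_quot_pi isder D).
  elim/lmod_quot_ind => D; rewrite sder_quot_to_odE; apply/esym/lmod_quot_piP.
  exact: isder_odpart _ hE.
move=> D; rewrite sder_quot_to_odE; apply: val_inj => /=.
exact/sder_odpart_id/valP.
Qed.

End Grassmann.

Theorem theorem3p1 (K : comPzRingType) (n : nat)
    (half : exists h : K, 2%:R * h = 1) (n_ge1 : (1 <= n)%N) :
  [/\ internal_direct_sum (fun p : bool => @sder_par K n p) predT,
      internal_direct_sum (fun i : 'I_n => @gev_partial K n i) (sder_par true),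
      [/\ [set` @sder_par K n false] = [set` isder],
          [set` @isder K n] = [set sad a | a in [set` gev']] &
          set_bij [set` @gev' K n] [set` isder] sad] &
      exists f : {linear sder_quot K n -> sder_od K n}, bijective f].
Proof.
case: half => h hE.
split.
- split=> [p|//|D _].
    exact: sder_par_submod_closed.
  exists [ffun p : bool => if p then sder_odpart D else D - sder_odpart D].
  split.
    split=> [[]|]; rewrite ?ffunE.
    + exact: sder_odpart_par.
    + exact/isder_par/(isder_odpart _ hE).
    + by rewrite big_bool !ffunE [RHS]addrC subrK.
  (* Taking odd parts is additive, fixes [v true] and kills [v false], so both components are
     forced. *)
  move=> v [vP Dv]; have Ev : sder_odpart D = v true.
    rewrite Dv big_bool sder_odpartD (sder_odpart_id (vP true)).
    by rewrite (sder_odpart_ev (vP false)) addr0.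
  by apply/ffunP => -[]; rewrite ffunE Ev // Dv big_bool addrC addKr.
- split=> [i|v vP|D DP].
  + exact: gev_partial_submod_closed.
  + apply: rpred_sum => i _; have /asboolP[r ->] := vP i.
    by apply: rpredZ; apply: partial_par.
  exists [ffun i => gev_part (D (gvar i)) *: partial i].
  split.
    split=> [i|]; first by rewrite ffunE; apply/asboolP; exists (gev_part (D (gvar i))).
    rewrite -[LHS](sder_odpart_id DP); apply: eq_bigr => i _.
    by rewrite ffunE.
  move=> v [vP Dv]; apply/ffunP => j; rewrite ffunE.
  have /choice[r vr] : forall i, exists r, v i = r *: partial i.
    by move=> i; apply/asboolP/vP.
  (* Evaluation at x_j isolates the coefficient of partial_j. *)
  rewrite vr; congr (_ *: _); apply: val_inj => /=.
  have -> : D (gvar j) = gev_val (r j).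
    by rewrite Dv -(gev_partial_sum_gvar r); congr (sder_fun _ _); apply: eq_bigr.
  by apply: gpart_uniq; rewrite ?subrr ?rpred0 ?gev_valP.
- split.
  + apply/seteqP; split=> D /= DP; last exact: isder_par.
    (* An even D equals D minus its odd part, hence is inner. *)
    by rewrite -[D]subr0 -(sder_odpart_ev DP) (isder_odpart _ hE).
  + exact: isder_gev' _ hE.
  split.
  + by move=> a _; apply/asboolP; exists a.
  + exact: sad_inj _ _ hE.
  + by rewrite (isder_gev' _ hE).
by exists (@sder_quot_to_od K n); apply: sder_quot_to_od_bij hE.
Qed.
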